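(* Let $F:\mathbb{R}^n\rightrightarrows\mathbb{R}^q$ be a polyhedral convex set-valued map, let $C\subseteq\mathbb{R}^q$ be a polyhedral convex cone, and let $\mathcal{P}$ be the upper image of the problem (P) of minimizing $F_C$ over $\mathbb{R}^n$. There exists a solution for (P) if and only if (P) is feasible and one of the following six conditions (which are equivalent to each other whenever (P) is feasible) is satisfied: (i) There exists $\bar y\in\mathcal{P}$ such that (P) has a minimizer $\bar x$ with $\bar y\in F(\bar x)+C$. (ii) For all $\bar y\in\mathcal{P}$, (P) has a minimizer $\bar x$ with $\bar y\in F(\bar x)+C$. (iii) There exists $\bar y\in\mathcal{P}$ such that the linear program (LP($\bar y$)) has an optimal solution. (iv) For all $\bar y\in\mathcal{P}$, the linear program (LP($\bar y$)) has an optimal solution. (v) The linear program (LP$_{\text{hom}}$) has an optimal solution. (vi) $0\in\mathbb{R}^n$ is a minimizer of (P$_{\text{hom}}$).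
   Context: A set-valued map $F:\mathbb{R}^n\rightrightarrows\mathbb{R}^q$ is polyhedral convex if its graph $\operatorname{gr}F=\{(x,y)\in\mathbb{R}^n\times\mathbb{R}^q : y\in F(x)\}$ is a convex polyhedron; $\operatorname{dom}F=\{x\in\mathbb{R}^n: F(x)\neq\emptyset\}$. For a polyhedral convex cone $C\subseteq\mathbb{R}^q$ put $F_C(x)=F(x)+C$ (with $\emptyset+C=\emptyset$); then $\operatorname{gr}F_C=\operatorname{gr}F+(\{0\}\times C)$. The polyhedral convex set optimization problem (P) is: minimize $F_C(x)$ over $x\in\mathbb{R}^n$ with respect to the ordering $\supseteq$. It is feasible if $\operatorname{dom}F\neq\emptyset$. The upper image of (P) is $\mathcal{P}=C+\bigcup_{x\in\mathbb{R}^n}F(x)$. The recession mapping $0^+F:\mathbb{R}^n\rightrightarrows\mathbb{R}^q$ of $F$ is defined by $\operatorname{gr}0^+F=0^+\operatorname{gr}F$, where $0^+Y$ denotes the recession cone of a convex polyhedron $Y$. One has (for feasible (P)) $(0^+F_C)(x)=(0^+F)(x)+C$. The homogeneous problem (P$_{\text{hom}}$) is: minimize $(0^+F_C)(x)$ over $x\in\mathbb{R}^n$ with respect to $\supseteq$, i.e. problem (P) with $F$ replaced by $0^+F$. Solution concept. A pair $(\bar S,\hat S)$ of finite sets $\bar S\subseteq\operatorname{dom}F$, $\bar S\neq\emptyset$, and $\hat S\subseteq\operatorname{dom}(0^+F)\setminus\{0\}$ (possibly empty) is a finite infimizer for (P) if $$\mathcal{P}=C+\operatorname{conv}\bigcup_{x\in\bar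 S}F(x)+\operatorname{cone}\bigcup_{x\in\hat S}(0^+F)(x),$$ where $\operatorname{conv}$ is the convex hull and $\operatorname{cone}Y$ is the smallest convex cone containing $Y$, with $\operatorname{cone}\emptyset=\{0\}$. A point $\bar x\in\operatorname{dom}F$ is a minimizer (minimizing point) of (P) if there is no $x\in\mathbb{R}^n$ with $F_C(x)\supsetneq F_C(\bar x)$. A nonzero $\hat x\in\operatorname{dom}(0^+F)$ is a minimizing direction for (P) if there is no $x\in\mathbb{R}^n$ with $(0^+F_C)(x)\supsetneq(0^+F_C)(\hat x)$. A solution to (P) is a finite infimizer $(\bar S,\hat S)$ such that all elements of $\bar S$ are minimizing points and all elements of $\hat S$ (if any) are minimizing directions. That $0$ is a minimizer of (P$_{\text{hom}}$) means that there is no $x\in\mathbb{R}^n$ with $(0^+F_C)(x)\supsetneq(0^+F_C)(0)$. Linear programs. Since $\operatorname{gr}F_C$ is a convex polyhedron, fix matrices $A\in\mathbb{R}^{m\times n}$, $B\in\mathbb{R}^{m\times q}$ and a vector $b\in\mathbb{R}^m$ such that $y\in F(x)+C\iff Ax+By\ge b$ (componentwise); then (for feasible (P)) $y\in(0^+F)(x)+C\iff Ax+By\ge 0$. Let $B_i$ denote the $i$-th row of $B$ and $[m]=\{1,\dots,m\}$. For a parameter $\bar y\in\mathbb{R}^q$, (LP($\bar y$)) is the linear program $$\min\ \sum_{i=1}^m B_i y^i\quad\text{s.t.}\quad y^i\in F(x)+C\ (i\in[m]),\quad \bar y\in F(x)+C,$$ and (LP$_{\text{hom}}$) is the linear program $$\min\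 \sum_{i=1}^m B_i y^i\quad\text{s.t.}\quad y^i\in (0^+F)(x)+C\ (i\in[m]),\quad 0\in (0^+F)(x)+C,$$ both with variables $(x,y^1,\dots,y^m)\in\mathbb{R}^n\times\mathbb{R}^q\times\dots\times\mathbb{R}^q$. *)

(* Defs.v *)
From HB Require Import structures.
From mathcomp Require Import all_boot all_order all_algebra.
From mathcomp Require Import all_classical all_reals.
From mathcomp Require Import convex.

Set Implicit Arguments.
Unset Strict Implicit.
Unset Printing Implicit Defensive.

Import Order.TTheory GRing.Theory Num.Theory.

Local Open Scope classical_set_scope.
Local Open Scope ring_scope.

Section ConvexSets.
Context {R : realType}.

Definition setadd {V : zmodType} (A B : set V) : set V :=
  [set a + b | a in A & b in B].

Definition vec_le {k : nat} (u v : 'cV[R]_k) : Prop :=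
  forall i, u i ord0 <= v i ord0.

(* Cones contain the origin, so that the cone generated by the empty set is
   [set 0]. *)
Definition cone_set {V : lmodType R} (K : set V) : Prop :=
  K 0 /\ forall (t : R) v, 0 <= t -> K v -> K (t *: v).

Definition convex_cone {V : lmodType R} (K : set V) : Prop :=
  convex_set (K : set (convex_lmodType V)) /\ cone_set K.

Definition conv_hull {V : lmodType R} (Y : set V) : set V :=
  smallest (fun K : set V => convex_set (K : set (convex_lmodType V))) Y.

Definition cone_hull {V : lmodType R} (Y : set V) : set V :=
  smallest convex_cone Y.

Definition polyhedron {k : nat} (Y : set 'cV[R]_k) : Prop :=
  exists (l : nat) (M : 'M[R]_(l, k)) (d : 'cV[R]_l),
    Y = [set z | vec_le d (M *m z)].

(* Only relevant for nonempty Y; for Y = set0 this is the whole space. *)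
Definition recession_cone {V : lmodType R} (Y : set V) : set V :=
  [set d | forall y t, Y y -> 0 <= t -> Y (y + t *: d)].

End ConvexSets.

Section SetOptimization.
Context {R : realType} {n q : nat}.
Implicit Types (F : 'cV[R]_n -> set 'cV[R]_q) (C : set 'cV[R]_q).

(* R^n x R^q is identified with R^(n + q) by stacking column vectors. *)
Definition graph F : set 'cV[R]_(n + q) :=
  [set z | F (usubmx z) (dsubmx z)].

Definition polyhedral_convex_map F : Prop := polyhedron (graph F).

Definition polyhedral_convex_cone C : Prop := polyhedron C /\ convex_cone C.

Definition dom F : set 'cV[R]_n := [set x | F x !=set0].

Definition plus_cone F C : 'cV[R]_n -> set 'cV[R]_q :=
  fun x => setadd (F x) C.

(* The mapping whose graph is the recession cone of the graph of F. *)
Definition recession_map F : 'cV[R]_n -> set 'cV[R]_q :=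
  fun x => [set y | recession_cone (graph F) (col_mx x y)].

Definition feasible F : Prop := dom F !=set0.

Definition upper_image F C : set 'cV[R]_q :=
  setadd C (\bigcup_(x in setT) F x).

(* G plays the role of F_C or of 0^+F_C. *)
Definition maximal_value (G : 'cV[R]_n -> set 'cV[R]_q) (xbar : 'cV[R]_n) :
  Prop := ~ exists x, G xbar `<` G x.

Definition minimizer F C (xbar : 'cV[R]_n) : Prop :=
  dom F xbar /\ maximal_value (plus_cone F C) xbar.

Definition minimizing_direction F C (xhat : 'cV[R]_n) : Prop :=
  [/\ xhat != 0, dom (recession_map F) xhat &
      maximal_value (recession_map (plus_cone F C)) xhat].

Definition zero_minimizes_hom F C : Prop :=
  maximal_value (recession_map (plus_cone F C)) 0.

Definition finite_infimizer F C (Sbar Shat : set 'cV[R]_n) : Prop :=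
  [/\ finite_set Sbar /\ finite_set Shat,
      Sbar !=set0, Sbar `<=` dom F,
      Shat `<=` dom (recession_map F) `\ 0 &
      upper_image F C =
        setadd (setadd C (conv_hull (\bigcup_(x in Sbar) F x)))
               (cone_hull (\bigcup_(x in Shat) recession_map F x))].

Definition solution F C (Sbar Shat : set 'cV[R]_n) : Prop :=
  [/\ finite_infimizer F C Sbar Shat,
      Sbar `<=` minimizer F C &
      Shat `<=` minimizing_direction F C].

(* Linear programs in the variables (x, y^1, ..., y^m). Applied to F this is
   (LP(ybar)); applied to the recession mapping of F and ybar = 0 it is
   (LP_hom). *)
Definition lp_feasible {m : nat} F C (ybar : 'cV[R]_q)
    (x : 'cV[R]_n) (y : 'I_m -> 'cV[R]_q) : Prop :=
  (forall i, plus_cone F C x (y i)) /\ plus_cone F C x ybar.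

Definition lp_objective {m : nat} (B : 'M[R]_(m, q))
    (y : 'I_m -> 'cV[R]_q) : R :=
  \sum_(i < m) (row i B *m y i) ord0 ord0.

Definition lp_has_optimal_solution {m : nat} (B : 'M[R]_(m, q)) F C
    (ybar : 'cV[R]_q) : Prop :=
  exists x (y : 'I_m -> 'cV[R]_q), lp_feasible F C ybar x y /\
    forall x' (y' : 'I_m -> 'cV[R]_q), lp_feasible F C ybar x' y' ->
      lp_objective B y <= lp_objective B y'.

Definition lp_hom_has_optimal_solution {m : nat} (B : 'M[R]_(m, q)) F C :
  Prop := lp_has_optimal_solution B (recession_map F) C 0.

End SetOptimization.

(* Main.v *)
From HB Require Import structures.
Require Import Defs.
From mathcomp Require Import all_boot all_order all_algebra.
From mathcomp Require Import all_classical all_reals.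
From mathcomp Require Import interval_inference convex lra ring.
Import Order.TTheory GRing.Theory Num.Theory.
Local Open Scope classical_set_scope.
Local Open Scope ring_scope.
Set Implicit Arguments.
Unset Strict Implicit.
Unset Printing Implicit Defensive.

(** Put G(x) = {y | A x + B y >= 0}. All six conditions say the same thing
    about this cone-valued map: whenever A x >= 0, i.e. whenever 0 is in
    G(x), which is the same as G(x) containing G(0), the set G(x) is no larger
    than G(0) ([no_free_enlargement]). That is condition (vi) spelled out,
    once it is known that G is both the recession mapping of F_C and
    0^+F + C.

    - If x' is a direction violating it, then F_C(x + t x') contains F_C(x) for
      every t >= 0 and cannot stay equal to F_C(x) for all t, because that
      would make a vector y' outside G(0) a recession direction of F_C(x).
      So (P) has no minimizer at all ([maximal_no_free_enlargement]). In the
      linear programs, moving along (x', y') in one single block y^i lowers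
      the objective while keeping feasibility
      ([lp_optimal_no_free_enlargement]).
    - Under the condition, every feasible direction of the homogeneous program
      satisfies B y^i >= 0, so the objective of LP(ybar) is nonnegative on the
      recession directions of the feasible set and the minimum is attained
      ([lp_attained]). The optimal x is a minimizer: a strictly larger value
      F_C(x') would contain a point breaking an inequality
      B_i y >= b_i - A_i x, and using it as the i-th block gives a smaller
      objective ([lp_optimal_maximal]). The same argument for the homogeneous
      problem produces minimizing directions.

    A solution is then obtained from a finite generation of the graph of F by
    points and rays: each point (x, y) is replaced by a minimizer x' with y
    in F_C(x'), and each ray (x, y) by a minimizing direction x' with y in
    (0^+F)(x') + C, except that the rays with y in G(0) are dropped, being
    recession directions of every value of F_C already ([solution_exists]).

    The theory of polyhedra behind this all comes from eliminating variables
    in systems of linear inequalities ([solvability_conditions]): the right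
    hand sides v for which v <= f w is solvable form a polyhedral cone. Applied
    to suitable systems it gives the attainment of linear programs
    ([linear_program_attained]), the commutation of projection with
    recession cones ([recession_of_solvability]), and the finite generation of
    polyhedra ([polyhedron_finitely_generated]). *)

(** * Elimination of variables and linear programs *)

Section Elimination.
Context {R : realFieldType}.

(** Linearity is spelled out on plain functions, so that forms can be
    composed with any map of right-hand sides that is visibly linear. *)
Definition linear_form (I : Type) (p : (I -> R) -> R) : Prop :=
  forall a u v, p (fun i => a * u i + v i) = a * p u + p v.

(** Multipliers of Fourier-Motzkin elimination: [fm_coef1] and [fm_coef2] are
    nonnegative weights for the inequalities [ij.1] and [ij.2] such that the
    weighted sum of the coefficients [beta] vanishes. An inequality that does
    not involve the variable is kept as it is. *)
Definition fm_coef1 (I : Type) (beta : I -> R) (ij : I * I) : R :=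
  if beta ij.1 == 0 then 1
  else if (0 < beta ij.1) && (beta ij.2 < 0) then - beta ij.2 else 0.

Definition fm_coef2 (I : Type) (beta : I -> R) (ij : I * I) : R :=
  if (0 < beta ij.1) && (beta ij.2 < 0) then beta ij.1 else 0.

(** The inequalities with [beta i > 0] bound [t] from below and those with
    [beta i < 0] bound it from above; a common [t] exists once every lower
    bound is below every upper bound, and the largest lower bound (or the
    smallest upper bound, if there is no lower one) is such a [t]. *)
Lemma fm_one_variable (I : finType) (alpha beta : I -> R) :
  (exists t, forall i, alpha i <= beta i * t) <->
  (forall ij, fm_coef1 beta ij * alpha ij.1 + fm_coef2 beta ij * alpha ij.2
              <= 0).
Proof.
rewrite /fm_coef1 /fm_coef2; split=> [[t ht] [i j]|h] /=.
  have := ht i; have := ht j; case: eqP => [->|_].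
    by rewrite ltxx /=; lra.
  by case: ifP => [/andP[]|_]; nra.
have h0 i : beta i = 0 -> alpha i <= 0.
  by move=> b0; have /= := h (i, i); rewrite b0 eqxx ltxx /=; lra.
have h1 i j : 0 < beta i -> beta j < 0 ->
    alpha i / beta i <= alpha j / beta j.
  move=> bi bj; have /= := h (i, j); rewrite bi bj (gt_eqF bi) /= => hij.
  by rewrite ler_pdivrMr // mulrAC ler_ndivlMr //; lra.
have low t i : 0 < beta i -> alpha i / beta i <= t -> alpha i <= beta i * t.
  by move=> bi; rewrite ler_pdivrMr // mulrC.
have upp t i : beta i < 0 -> t <= alpha i / beta i -> alpha i <= beta i * t.
  by move=> bi; rewrite ler_ndivlMr // mulrC.
have [i0 bi0|npos] := pickP (fun i => 0 < beta i).
  have [i bi imax] := arg_maxP (P := fun i => 0 < beta i)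
    (fun i => alpha i / beta i) bi0.
  exists (alpha i / beta i) => j.
  case: (ltrgt0P (beta j)) => bj; last by rewrite bj mul0r h0.
  - by apply: low => //; exact: imax.
  - by apply: upp => //; exact: h1.
have [j0 bj0|nneg] := pickP (fun i => beta i < 0).
  have [j bj jmin] := arg_minP (P := fun i => beta i < 0)
    (fun i => alpha i / beta i) bj0.
  exists (alpha j / beta j) => i.
  case: (ltrgt0P (beta i)) => bi; last by rewrite bi mul0r h0.
  - by rewrite npos in bi.
  - by apply: upp => //; exact: jmin.
exists 0 => i; rewrite mulr0; apply: h0.
by case: (ltrgt0P (beta i)) => // bi; rewrite ?npos ?nneg in bi.
Qed.

(** Fourier-Motzkin elimination. The conditions [p] depend on the matrix only,
    not on the right-hand side: this uniformity is what makes the result as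
    strong as the Farkas lemma. *)
Lemma fm_coordinates k (I : finType) (N : I -> 'I_k -> R) :
  exists (J : finType) (p : J -> (I -> R) -> R),
    (forall j, linear_form (p j)) /\
    forall v : I -> R,
      (exists w : 'I_k -> R, forall i, v i <= \sum_l N i l * w l) <->
      (forall j, p j v <= 0).
Proof.
elim: k I N => [|k IHk] I N.
  exists I, (fun i v => v i); split=> // v; split=> [[w hw] i|hv].
    by have := hw i; rewrite big_ord0.
  by exists (fun=> 0) => i; rewrite big_ord0.
pose beta i := N i ord0.
pose c1 := fm_coef1 beta; pose c2 := fm_coef2 beta.
pose comb v (ij : I * I) : R := c1 ij * v ij.1 + c2 ij * v ij.2.
pose N' ij l := comb (fun i => N i (lift ord0 l)) ij.
have [J [p [plin pP]]] := IHk _ N'.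
exists J, (fun j v => p j (comb v)); split=> [j a u v|v].
  rewrite -plin; congr (p j _); apply/funext => ij; rewrite /comb; ring.
rewrite -pP.
have fmE w : (exists t, forall i, v i - \sum_l N i (lift ord0 l) * w l
                                  <= beta i * t) <->
             (forall ij, comb v ij <= \sum_l N' ij l * w l).
  rewrite fm_one_variable.
  have sumE ij : \sum_l N' ij l * w l =
      c1 ij * (\sum_l N ij.1 (lift ord0 l) * w l) +
      c2 ij * (\sum_l N ij.2 (lift ord0 l) * w l).
    rewrite !mulr_sumr -big_split /=; apply: eq_bigr => l _.
    by rewrite /N' /comb; ring.
  by split=> h ij; have := h ij; rewrite sumE /comb -/c1 -/c2; lra.
split=> [[w hw]|[w /fmE[t ht]]].
  exists (fun l => w (lift ord0 l)); apply/fmE; exists (w ord0) => i.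
  by have := hw i; rewrite big_ord_recl /beta; lra.
exists (fun l => if unlift ord0 l is Some l' then w l' else t) => i.
rewrite big_ord_recl unlift_none.
under eq_bigr do rewrite liftK.
by have := ht i; rewrite /beta; lra.
Qed.

(** The Farkas lemma without multipliers, for functionals on any
    finite-dimensional space: for systems over products and function spaces
    no matrix has to be assembled. *)
Lemma solvability_conditions (V : vectType R) (I : finType) (f : I -> V -> R)
    (f_lin : forall i, scalar (f i)) :
  exists (J : finType) (p : J -> (I -> R) -> R),
    (forall j, linear_form (p j)) /\
    forall v : I -> R,
      (exists w, forall i, v i <= f i w) <-> (forall j, p j v <= 0).
Proof.
pose dimV : nat := \dim (fullv : {vspace V}).
pose e : dimV.-tuple V := vbasis fullv.
have [J [p [plin pP]]] := fm_coordinates (fun i (l : 'I_dimV) => f i e`_l).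
exists J, p; split=> // v; rewrite -pP.
have fE i (w : 'I_dimV -> R) :
    f i (\sum_(l < dimV) w l *: e`_l) = \sum_(l < dimV) f i e`_l * w l.
  pose F := GRing.isLinear.Build _ _ _ _ _ (f_lin i).
  pose g : {scalar V} := HB.pack (f i) F.
  rewrite -[f i]/(g : V -> R) linear_sum; apply: eq_bigr => l _.
  by rewrite scalarZ mulrC.
split=> [[w hw]|[w hw]].
  exists (fun l => coord e l w) => i.
  by rewrite -fE -coord_vbasis ?memvf.
by exists (\sum_(l < dimV) w l *: e`_l) => i; rewrite fE.
Qed.

Lemma linear_form0 (I : Type) (p : (I -> R) -> R) :
  linear_form p -> p (fun=> 0) = 0.
Proof.
move=> p_lin.
have -> : (fun=> 0) =
    (fun i : I => -1 * (fun=> 0 : R) i + (fun=> 0) i) :> (I -> R).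
  by apply/funext => i; rewrite mulr0 addr0.
by rewrite p_lin; lra.
Qed.

Lemma le0_of_ray (a c : R) : (forall t, 0 <= t -> t * a <= c) -> a <= 0.
Proof.
move=> h; rewrite leNgt; apply/negP => a0.
have c0 : 0 <= c by have := h 0 (lexx _); rewrite mul0r.
(* At this t the product t * a is c + 1. *)
have t0 : 0 <= (c + 1) / a by apply: divr_ge0; [lra|exact: ltW].
by have := h _ t0; rewrite divfK ?gt_eqF //; lra.
Qed.

(** Solvability along the whole ray [v + t u] passes to [u], although the
    solutions [w] may depend on [t] without any control: each condition
    [p j (t u + v) <= 0] is affine in [t]. Geometrically, a recession direction
    of a projected polyhedron lifts to one of the polyhedron. *)
Lemma recession_of_solvability (V : vectType R) (I : finType)
    (f : I -> V -> R) (f_lin : forall i, scalar (f i)) (v u : I -> R) :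
  (forall t, 0 <= t -> exists w, forall i, t * u i + v i <= f i w) ->
  exists w, forall i, u i <= f i w.
Proof.
have [J [p [plin pP]]] := solvability_conditions f_lin.
move=> h; apply/pP => j; apply: (@le0_of_ray _ (- p j v)) => t t0.
have [w hw] := h t t0.
have /pP/(_ j) : exists w, forall i, t * u i + v i <= f i w by exists w.
by rewrite plin; lra.
Qed.

(** Adding the inequality [c w <= s] and eliminating [w] describes the upper
    bounds [s] of attainable values by finitely many inequalities
    [p j (v d 0) <= s * q j]. Some [q j] is positive, since otherwise [s = -1]
    would be attained on the recession cone; hence there is a smallest [s]. *)
Lemma linear_program_attained (V : vectType R) (I : finType)
    (f : I -> V -> R) (f_lin : forall i, scalar (f i)) (d : I -> R)
    (c : V -> R) (c_lin : scalar c) :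
  (exists w, forall i, d i <= f i w) ->
  (forall w, (forall i, 0 <= f i w) -> 0 <= c w) ->
  exists w, (forall i, d i <= f i w) /\
    forall w', (forall i, d i <= f i w') -> c w <= c w'.
Proof.
move=> [w0 hw0] crec.
pose g (o : option I) w := if o is Some i then f i w else - c w.
have g_lin o : scalar (g o).
  by case: o => [i|] a x y /=; rewrite ?f_lin // c_lin; lra.
pose v (d : I -> R) s (o : option I) := if o is Some i then d i else - s.
have [J [p [plin pP]]] := solvability_conditions g_lin.
pose q j := - p j (v (fun=> 0) 1).
have pE d' j s : p j (v d' s) = p j (v d' 0) - s * q j.
  rewrite /q mulrN opprK addrC -plin; congr (p j _); apply/funext => -[i|] /=.
    by rewrite mulr0 add0r.
  by lra.
have valP d' s : (exists w, (forall i, d' i <= f i w) /\ c w <= s) <->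
    forall j, p j (v d' 0) <= s * q j.
  have -> : (forall j, p j (v d' 0) <= s * q j) <->
            (forall j, p j (v d' s) <= 0).
    by split=> h j; have := h j; rewrite (pE d' j s); lra.
  rewrite -pP; split=> [[w [hw cw]]|[w hw]]; exists w.
    by case=> [i|] /=; [exact: hw|lra].
  by split=> [i|]; [exact: hw (Some i)|have := hw None => /=; lra].
have p0 j : p j (v (fun=> 0) 0) = 0.
  have -> : v (fun=> 0) 0 = (fun=> 0).
    by apply/funext => -[i|] //=; rewrite oppr0.
  exact: linear_form0.
have [j0 qj0] : exists j, 0 < q j.
  apply: contrapT => nq.
  have /valP [w [hw cw]] : forall j, p j (v (fun=> 0) 0) <= -1 * q j.
    move=> j; rewrite p0 mulN1r oppr_ge0 leNgt; apply/negP => qj.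
    by apply: nq; exists j.
  by have := crec w hw; lra.
have [j qj jmax] := arg_maxP (P := fun j => 0 < q j)
  (fun j => p j (v d 0) / q j) qj0.
set s := p j (v d 0) / q j in jmax.
have low w : (forall i, d i <= f i w) -> s <= c w.
  move=> hw; have /valP/(_ j) :
    exists w', (forall i, d i <= f i w') /\ c w' <= c w by exists w.
  by rewrite /s ler_pdivrMr.
have /valP [w [hw cw]] : forall j, p j (v d 0) <= s * q j.
  move=> l; case: (ltP 0 (q l)) => ql.
    by rewrite -ler_pdivrMr //; exact: jmax.
  have /valP/(_ l) :
    exists w, (forall i, d i <= f i w) /\ c w <= c w0 by exists w0.
  (* For q l <= 0 the condition is inherited from the larger value c w0. *)
  by have := low _ hw0; nra.
by exists w; split=> // w' hw'; exact: le_trans cw (low _ hw').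
Qed.

End Elimination.
(** * Finitely generated cones *)

Section FiniteGeneration.
Context {R : realFieldType}.

Definition dot k (u z : 'cV[R]_k) : R := \sum_r u r ord0 * z r ord0.

Definition finite_cone k (I : finType) (g : I -> 'cV[R]_k) : set 'cV[R]_k :=
  [set z | exists2 lam : I -> R, forall i, 0 <= lam i &
                                 z = \sum_i lam i *: g i].

Lemma dotC k (u z : 'cV[R]_k) : dot u z = dot z u.
Proof. by apply: eq_bigr => r _; rewrite mulrC. Qed.

Lemma dot_scalar k (u : 'cV[R]_k) : scalar (dot u).
Proof.
move=> a x y; rewrite /dot mulr_sumr -big_split /=.
by apply: eq_bigr => r _; rewrite !mxE; ring.
Qed.

Lemma scalar_sum (V : lmodType R) (f : V -> R) (f_lin : scalar f)
    (I : finType) (lam : I -> R) (g : I -> V) :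
  f (\sum_i lam i *: g i) = \sum_i lam i * f (g i).
Proof.
pose F := GRing.isLinear.Build _ _ _ _ _ f_lin.
pose h : {scalar V} := HB.pack f F.
rewrite -[f]/(h : V -> R) linear_sum; apply: eq_bigr => i _.
by rewrite scalarZ.
Qed.

Lemma scalar_is_dot k (f : 'cV[R]_k -> R) (f_lin : scalar f) :
  exists u, forall z, f z = dot u z.
Proof.
exists (\col_r f (delta_mx r ord0)) => z.
have {1}-> : z = \sum_r z r ord0 *: delta_mx r ord0.
  by rewrite {1}[z]matrix_sum_delta; apply: eq_bigr => r _; rewrite big_ord1.
rewrite scalar_sum //; apply: eq_bigr => r _.
by rewrite mxE mulrC.
Qed.

Lemma dot_finite_cone k (I : finType) (g : I -> 'cV[R]_k) u z :
  finite_cone g z -> (forall i, 0 <= dot u (g i)) -> 0 <= dot u z.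
Proof.
move=> [lam lam0 ->] ug; rewrite scalar_sum; last exact: dot_scalar.
by apply: sumr_ge0 => i _; rewrite mulr_ge0.
Qed.

Lemma finite_cone_gen k (I : finType) (g : I -> 'cV[R]_k) i :
  finite_cone g (g i).
Proof.
exists (fun j => (j == i)%:R) => [j|]; first by case: eqP.
rewrite (bigD1 i) //= eqxx scale1r big1 ?addr0 // => j /negPf ->.
by rewrite scale0r.
Qed.

(** Weyl's theorem: eliminate the coefficients from the system expressing that
    [z] is a nonnegative combination of the generators. *)
Lemma finite_cone_polyhedral k (I : finType) (g : I -> 'cV[R]_k) :
  exists (J : finType) (h : J -> 'cV[R]_k),
    forall z, finite_cone g z <-> forall j, 0 <= dot (h j) z.
Proof.
(* Each coordinate of z = \sum_i lam i *: g i is split into two inequalities. *)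
pose f (o : 'I_k + 'I_k + I) (lam : {ffun I -> R^o}) : R := match o with
  | inl (inl r) => \sum_i lam i * g i r ord0
  | inl (inr r) => - \sum_i lam i * g i r ord0
  | inr i => lam i end.
pose v (z : 'cV[R]_k) (o : 'I_k + 'I_k + I) : R := match o with
  | inl (inl r) => z r ord0 | inl (inr r) => - z r ord0 | inr i => 0 end.
have sum_lin r :
    scalar (fun lam : {ffun I -> R^o} => \sum_i lam i * g i r ord0).
  move=> a x y; rewrite mulr_sumr -big_split /=.
  by apply: eq_bigr => i _; rewrite !ffunE mulrDl -mulrA.
have f_lin o : scalar (f o).
  case: o => [[r|r]|i] a x y /=; rewrite ?sum_lin ?opprD -?mulrN //.
  by rewrite !ffunE.
have [J [p [plin pP]]] := solvability_conditions f_lin.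
have q_lin j : scalar (fun z => - p j (v z)).
  move=> a x y; rewrite mulrN -opprD -plin; congr (- p j _).
  by apply/funext => -[[r|r]|i] /=; rewrite ?mxE; ring.
have [h hP] := choice (fun j => scalar_is_dot (q_lin j)).
exists J, h => z.
have -> : (forall j, 0 <= dot (h j) z) <-> (forall j, p j (v z) <= 0).
  by split=> H j; have := H j; rewrite -hP oppr_ge0.
have coordE (lam : I -> R) r :
    (\sum_i lam i *: g i) r ord0 = \sum_i lam i * g i r ord0.
  by rewrite summxE; apply: eq_bigr => i _; rewrite mxE.
rewrite -pP; split=> [[lam lam0 ->]|[lam lamP]].
  exists [ffun i => lam i : R^o] => -[[r|r]|i] /=; rewrite ?ffunE //;
    by rewrite coordE ?lerN2 le_eqVlt; apply/orP; left; apply/eqP;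
       apply: eq_bigr => i _; rewrite ffunE.
exists lam => [i|]; first exact: lamP (inr i).
apply/colP => r; rewrite coordE; apply/le_anti/andP; split.
  exact: lamP (inl (inl r)).
by rewrite -lerN2; exact: lamP (inl (inr r)).
Qed.

(** Minkowski's theorem, from Weyl's by duality: describe the cone generated by
    the constraint normals [a] by inequalities with normals [g]. These [g]
    generate the polyhedral cone; for the nontrivial inclusion, an inequality
    [h l] valid on the cone of [g] lies itself in the cone of [a]. *)
Lemma polyhedral_cone_finite k (I : finType) (a : I -> 'cV[R]_k) :
  exists (J : finType) (g : J -> 'cV[R]_k),
    forall z, (forall i, 0 <= dot (a i) z) <-> finite_cone g z.
Proof.
have [J [g gP]] := finite_cone_polyhedral a.
exists J, g => z; split=> [az|gz i]; last first.
  apply: dot_finite_cone gz _ => j; rewrite dotC; move: j.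
  by apply/gP; exact: finite_cone_gen.
have [L [h hP]] := finite_cone_polyhedral g.
have hg j : forall l, 0 <= dot (h l) (g j).
  by apply/hP; exact: finite_cone_gen.
apply/hP => l; rewrite dotC; apply: (@dot_finite_cone _ _ a).
  by apply/gP => j; rewrite dotC.
by move=> i; rewrite dotC.
Qed.

End FiniteGeneration.

(** * Finite generation of polyhedra *)

Section ConvexityInModules.
Context {R : realType}.

Lemma convex_setP (V : lmodType R) (K : set V) :
  convex_set (K : set (convex_lmodType V)) <->
  forall (t : R) x y, 0 <= t -> t <= 1 -> K x -> K y ->
    K (t *: x + (1 - t) *: y).
Proof.
split=> [cK t x y t0 t1 Kx Ky|cK x y t /set_mem Kx /set_mem Ky].
  have t01 : 0 <= t <= 1 by rewrite t0.
  have := cK x y (Itv01 t0 t1) (mem_set Kx) (mem_set Ky).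
  by move/set_mem.
by apply/mem_set; apply: cK.
Qed.

End ConvexityInModules.

Section PolyhedronGeneration.
Context {R : realType}.

Lemma addcE k (u v : 'cV[R]_k) r : (u + v) r ord0 = u r ord0 + v r ord0.
Proof. by rewrite mxE. Qed.

Lemma scalcE k a (u : 'cV[R]_k) r : (a *: u) r ord0 = a * u r ord0.
Proof. by rewrite mxE. Qed.

Lemma oppcE k (u : 'cV[R]_k) r : (- u) r ord0 = - u r ord0.
Proof. by rewrite mxE. Qed.

Lemma dot_col_mx k (a z : 'cV[R]_k) (c s : R) :
  dot (col_mx a (const_mx c : 'cV_1)) (col_mx z (const_mx s)) = dot a z + c * s.
Proof.
rewrite /dot big_split_ord big_ord1 /=; congr (_ + _).
  by apply: eq_bigr => i _; rewrite !col_mxEu.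
by rewrite !col_mxEd !mxE.
Qed.

Lemma mulmx_dot l k (M : 'M[R]_(l, k)) i z :
  (M *m z) i ord0 = dot (row i M)^T z.
Proof. by rewrite mxE; apply: eq_bigr => j _; rewrite !mxE. Qed.

(** The cone over D x {1}, completed at height 0 by the recession
    directions of D. *)
Definition perspective k (D : set 'cV[R]_k) (z : 'cV[R]_k) (s : R) : Prop :=
  0 < s /\ D (s^-1 *: z) \/ s = 0 /\ recession_cone D z.

Lemma perspectiveD k (D : set 'cV[R]_k) z1 s1 z2 s2 :
  convex_set (D : set (convex_lmodType _)) ->
  perspective D z1 s1 -> perspective D z2 s2 ->
  perspective D (z1 + z2) (s1 + s2).
Proof.
have mixed z s z' : 0 < s -> D (s^-1 *: z) -> recession_cone D z' ->
    D (s^-1 *: (z + z')).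
  by move=> s0 Dz recz; rewrite scalerDr; apply: recz; rewrite ?invr_ge0 ?ltW.
move/convex_setP => cD [[s10 D1]|[-> D1]] [[s20 D2]|[-> D2]].
- left; split; first exact: addr_gt0.
  have s0 : 0 < s1 + s2 by exact: addr_gt0.
  have /(_ _)/(_ _) := cD (s1 / (s1 + s2)) _ _ _ _ D1 D2.
  rewrite divr_ge0 ?(ltW s10) ?(ltW s0) // ler_pdivrMr // mul1r lerDl ltW //.
  move=> /(_ isT isT); congr (D _).
  rewrite !scalerA scalerDr; congr (_ *: _ + _ *: _).
    by field; rewrite !gt_eqF.
  by field; rewrite !gt_eqF.
- by left; rewrite addr0; split=> //; exact: mixed.
- by left; rewrite add0r addrC; split=> //; exact: mixed.
- right; rewrite addr0; split=> // x t Dx t0.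
  by rewrite scalerDr addrA; apply: D2 => //; exact: D1.
Qed.

Lemma perspectiveZ k (D : set 'cV[R]_k) z s a :
  0 <= a -> perspective D z s -> perspective D (a *: z) (a * s).
Proof.
rewrite le_eqVlt => /predU1P[<- _|a0 [[s0 Dz]|[-> Dz]]].
- by right; rewrite mul0r scale0r; split=> // x t Dx _; rewrite scaler0 addr0.
- left; split; first exact: mulr_gt0.
  by rewrite scalerA invfM mulrAC mulVf ?mul1r // gt_eqF.
- right; rewrite mulr0; split=> // x t Dx t0.
  by rewrite scalerA; apply: Dz => //; rewrite mulr_ge0 // ltW.
Qed.

Lemma recession_cone_polyhedron l k (M : 'M[R]_(l, k)) (d : 'cV[R]_l) z0 z :
  vec_le d (M *m z0) ->
  recession_cone [set y | vec_le d (M *m y)] z <-> vec_le 0 (M *m z).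
Proof.
move=> dz0; split=> [rz i|Mz y t dy t0 i]; rewrite !mxE.
  rewrite -oppr_le0; apply: (@le0_of_ray _ _ ((M *m z0) i ord0 - d i ord0)).
  move=> t t0; have := rz _ _ dz0 t0 i.
  by rewrite mulmxDr -scalemxAr !mxE; lra.
have := Mz i; have := dy i; rewrite !mxE => dyi Mzi.
rewrite -[leLHS]addr0.
rewrite (eq_bigr (fun j => M i j * y j ord0 + t * (M i j * z j ord0))).
  by rewrite big_split /= -mulr_sumr lerD // mulr_ge0.
by move=> j _; rewrite !mxE; ring.
Qed.

(** Homogenize: the cone of all (z, s) with [M z >= s d] and [s >= 0] is
    finitely generated; generators with [s > 0], scaled to height 1, are the
    points [V], those with [s = 0] the rays [W]. Generation is expressed by
    minimality among convex sets, which spares the bookkeeping of coefficients: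
    for a given [D] the argument takes place in [perspective D], a convex cone
    containing all generators. *)
Lemma polyhedron_finitely_generated k (Y : set 'cV[R]_k) :
  polyhedron Y -> exists V W : set 'cV[R]_k,
    [/\ finite_set V, finite_set W, V `<=` Y, W `<=` recession_cone Y &
      forall D : set 'cV[R]_k, convex_set (D : set (convex_lmodType _)) ->
        V `<=` D -> W `<=` recession_cone D -> Y `<=` D].
Proof.
move=> [l [M [d ->]]].
pose a (o : option 'I_l) : 'cV[R]_(k + 1) :=
  if o is Some i then col_mx (row i M)^T (const_mx (- d i ord0))
  else col_mx 0 (const_mx 1).
have [J [g gP]] := polyhedral_cone_finite a.
pose z j := usubmx (g j); pose s j := dsubmx (g j) ord0 ord0.
have gE j : g j = col_mx (z j) (const_mx (s j)).
  rewrite -[LHS]vsubmxK; congr col_mx; apply/colP => i.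
  by rewrite [RHS]mxE ord1.
have coneP x r : finite_cone g (col_mx x (const_mx r)) <->
    vec_le (r *: d) (M *m x) /\ 0 <= r.
  rewrite -gP; split=> [h|[h r0] [i|]].
  - split=> [i|]; last first.
      have := h None; rewrite /= dot_col_mx /dot big1 => [|i _]; first lra.
      by rewrite mxE mul0r.
    by have := h (Some i); rewrite /= dot_col_mx mulmx_dot mxE; lra.
  - by have := h i; rewrite /= dot_col_mx mulmx_dot mxE; lra.
  - rewrite /= dot_col_mx /dot big1 ?add0r ?mul1r // => i _.
    by rewrite mxE mul0r.
have zs j : vec_le (s j *: d) (M *m z j) /\ 0 <= s j.
  by apply/coneP; rewrite -gE; exact: finite_cone_gen.
exists [set (s j)^-1 *: z j | j in [set j | 0 < s j]],
       [set z j | j in [set j | s j = 0]].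
split.
- exact/finite_image/finite_finset.
- exact/finite_image/finite_finset.
- move=> _ [j /= sj <-] i; have [/(_ i)] := zs j.
  by rewrite -scalemxAr !mxE => h _; rewrite ler_pdivlMl.
- move=> _ [j /= sj <-] y t dy t0 i; have [/(_ i)] := zs j.
  rewrite sj scale0r mulmxDr -scalemxAr !mxE => h _.
  by have := dy i; rewrite mxE; nra.
move=> D cD VD WD x /= dx.
have /coneP[lam lam0 xE] : vec_le (1 *: d) (M *m x) /\ 0 <= 1 :> R.
  by rewrite scale1r.
have : perspective D (\sum_j lam j *: z j) (\sum_j lam j * s j).
  apply: (big_ind2 (perspective D)) => [|z1 s1 z2 s2|j _].
  - by right; split=> // y t Dy _; rewrite scaler0 addr0.
  - exact: perspectiveD.
  - apply: perspectiveZ => //; have [_] := zs j.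
    rewrite le_eqVlt => /predU1P[/esym sj|sj]; last first.
      by left; split=> //; apply: VD; exists j.
    by right; split=> //; apply: WD; exists j.
have -> : \sum_j lam j *: z j = x.
  have := congr1 usubmx xE; rewrite col_mxKu => ->.
  by rewrite linear_sum; apply: eq_bigr => j _; rewrite linearZ.
have -> : \sum_j lam j * s j = 1.
  have := congr1 (fun u => dsubmx u ord0 ord0) xE.
  rewrite col_mxKd mxE => ->; rewrite linear_sum summxE.
  by apply: eq_bigr => j _; rewrite linearZ mxE.
by case=> [[_]|[/eqP]]; rewrite ?invr1 ?scale1r // oner_eq0.
Qed.

End PolyhedronGeneration.

(** * Convex hulls, cones and their recession directions *)

Section ConvexCones.
Context {R : realType}.
Local Notation convex K := (convex_set (K : set (convex_lmodType _))).

Lemma convex_setadd (V : lmodType R) (K L : set V) :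
  convex K -> convex L -> convex (setadd K L).
Proof.
move=> /convex_setP cK /convex_setP cL; apply/convex_setP.
move=> t _ _ t0 t1 [x1 Kx1] [y1 Ly1 <-] [x2 Kx2] [y2 Ly2 <-].
exists (t *: x1 + (1 - t) *: x2); first exact: cK.
exists (t *: y1 + (1 - t) *: y2); first exact: cL.
by rewrite !scalerDr addrACA.
Qed.

Lemma convex_smallest (V : lmodType R) (P : set V -> Prop) (Y : set V) :
  (forall K, P K -> convex K) -> convex (smallest P Y).
Proof.
move=> Pc; apply/convex_setP => t x y t0 t1 Yx Yy K KP.
by have [/Pc/convex_setP cK _] := KP; apply: cK => //; [exact: Yx|exact: Yy].
Qed.

Lemma convex_conv_hull (V : lmodType R) (Y : set V) : convex (conv_hull Y).
Proof. exact: convex_smallest. Qed.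

Lemma convex_cone_hull (V : lmodType R) (Y : set V) : convex_cone (cone_hull Y).
Proof.
split; first by apply: convex_smallest => K [].
split=> [K [[_ []]] //|t v t0 Yv K KP].
by have [[_ [_ KZ]] _] := KP; apply: KZ => //; exact: Yv.
Qed.

Lemma convex_cone_recession (V : lmodType R) (K : set V) :
  convex_cone K -> K `<=` recession_cone K.
Proof.
move=> [/convex_setP cK [_ KZ]] d Kd x t Kx t0.
(* A sum in a convex cone is the midpoint of the doubled summands. *)
have -> : x + t *: d = 2^-1 *: (2 *: x) + (1 - 2^-1) *: ((2 * t) *: d).
  by rewrite !scalerA mulVf ?pnatr_eq0 // scale1r; congr (_ + _ *: _); field.
apply: cK; [lra|lra|exact: KZ|apply: KZ => //; lra].
Qed.

Lemma recession_cone_convex_cone (V : lmodType R) (K : set V) :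
  convex K -> convex_cone (recession_cone K).
Proof.
move=> /convex_setP cK; split; last split.
- apply/convex_setP => s d e s0 s1 rd re x t Kx t0.
  have -> : x + t *: (s *: d + (1 - s) *: e) =
      s *: (x + t *: d) + (1 - s) *: (x + t *: e).
    rewrite !scalerDr !scalerA addrACA -scalerDl subrKC scale1r.
    by rewrite ![t * _]mulrC.
  by apply: cK => //; [exact: rd|exact: re].
- by move=> x t Kx _; rewrite scaler0 addr0.
- move=> a d a0 rd x t Kx t0; rewrite scalerA.
  by apply: rd => //; exact: mulr_ge0.
Qed.

Lemma recession_coneD (V : lmodType R) (K : set V) d e :
  recession_cone K d -> recession_cone K e -> recession_cone K (d + e).
Proof.
by move=> rd re x t Kx t0; rewrite scalerDr addrA; apply: re => //; exact: rd.
Qed.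

Lemma recession_setaddl (V : lmodType R) (K L : set V) d :
  recession_cone K d -> recession_cone (setadd K L) d.
Proof.
move=> rd _ t [x Kx [y Ly <-]] t0.
by rewrite addrAC; exists (x + t *: d); [exact: rd|exists y].
Qed.

Lemma recession_setaddr (V : lmodType R) (K L : set V) d :
  recession_cone L d -> recession_cone (setadd K L) d.
Proof.
move=> rd _ t [x Kx [y Ly <-]] t0.
by rewrite -addrA; exists x => //; exists (y + t *: d) => //; exact: rd.
Qed.

(** The vectors [x] with [x + t *: d] in the hull form a convex set that
    contains the generators. *)
Lemma recession_conv_hull (V : lmodType R) (I : Type) (S : set I)
    (G : I -> set V) d :
  (forall i, S i -> recession_cone (G i) d) ->
  recession_cone (conv_hull (\bigcup_(i in S) G i)) d.
Proof.
move=> rd x t hx t0.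
apply: (hx (fun x => conv_hull (\bigcup_(i in S) G i) (x + t *: d))); split.
  have /convex_setP cH := @convex_conv_hull V (\bigcup_(i in S) G i).
  apply/convex_setP => s u v s0 s1 hu hv.
  have -> : s *: u + (1 - s) *: v + t *: d =
      s *: (u + t *: d) + (1 - s) *: (v + t *: d).
    by rewrite !scalerDr addrACA -scalerDl subrKC scale1r.
  exact: cH.
move=> y [i Si Giy]; apply: sub_gen_smallest.
by exists i => //; exact: rd.
Qed.

End ConvexCones.

(** * The linear programs and the minimizers *)

Section ParametricLP.
Context {R : realType} {n q m : nat}.
Variables (A : 'M[R]_(m, n)) (B : 'M[R]_(m, q)).

(** Moving [x] in a direction that keeps all points of the values
    {y | A x + B y >= b} never adds recession directions to them. *)
Definition no_free_enlargement : Prop :=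
  forall x y, vec_le 0 (A *m x) -> vec_le 0 (A *m x + B *m y) ->
    vec_le 0 (B *m y).

Variables (F : 'cV[R]_n -> set 'cV[R]_q) (C : set 'cV[R]_q) (b : 'cV[R]_m).
Hypothesis hAB : forall x y, plus_cone F C x y <-> vec_le b (A *m x + B *m y).

Lemma lp_objectiveE (y : 'I_m -> 'cV[R]_q) :
  lp_objective B y = \sum_i (B *m y i) i ord0.
Proof. by apply: eq_bigr => i _; rewrite -row_mul mxE. Qed.

(** By [no_free_enlargement], each summand of the objective is nonnegative on
    the directions of the feasible set. *)
Lemma lp_attained ybar : no_free_enlargement ->
  (exists x, plus_cone F C x ybar) -> lp_has_optimal_solution B F C ybar.
Proof.
move=> gain [x0 hx0].
pose V : vectType R := ('cV[R]_n * {ffun 'I_m -> 'cV[R]_q})%type.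
pose f (o : 'I_m * 'I_m + 'I_m) (w : V) : R := match o with
  | inl (i, r) => (A *m w.1 + B *m w.2 i) r ord0
  | inr r => (A *m w.1) r ord0 end.
pose d (o : 'I_m * 'I_m + 'I_m) : R := match o with
  | inl (i, r) => b r ord0 | inr r => b r ord0 - (B *m ybar) r ord0 end.
have mulmx_scalar k (M : 'M[R]_(m, k)) r : scalar (fun x => (M *m x) r ord0).
  by move=> a x y; rewrite linearP !mxE.
have f_lin o : scalar (f o).
  case: o => [[i r]|r] a x y /=; last exact: mulmx_scalar.
  by rewrite !ffunE !linearP !mxE; ring.
have c_lin : scalar (fun w : V => lp_objective B w.2).
  move=> a x y; rewrite !lp_objectiveE mulr_sumr -big_split /=.
  by apply: eq_bigr => i _; rewrite !ffunE mulmx_scalar.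
have feasP w : (forall o, d o <= f o w) <-> lp_feasible F C ybar w.1 w.2.
  split=> [h|[h hbar] [[i r]|r]] /=.
  - split=> [i|]; apply/hAB => r; first exact: h (inl (i, r)).
    by have := h (inr r); rewrite /= addcE; lra.
  - by have /hAB := h i; apply.
  - by have /hAB/(_ r) := hbar; rewrite addcE /=; lra.
have [||w [/feasP wf wmin]] := linear_program_attained f_lin (d := d) c_lin.
- by exists (x0, [ffun=> ybar]); apply/feasP; split=> [i|] //=; rewrite ffunE.
- move=> w hw; rewrite lp_objectiveE; apply: sumr_ge0 => i _.
  have := @gain w.1 (w.2 i) _ _ i; rewrite mxE; apply=> r; rewrite [leLHS]mxE.
    exact: hw (inr r).
  exact: hw (inl (i, r)).
exists w.1, w.2; split=> // x' y' [h' hbar'].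
have -> : lp_objective B y' = lp_objective B (finfun y').
  by apply: eq_bigr => i _; rewrite ffunE.
apply: (wmin (x', finfun y')); apply/feasP; split=> [i|] //=.
by rewrite ffunE.
Qed.

Lemma objective_update (y : 'I_m -> 'cV[R]_q) i z :
  lp_objective B (fun j => if j == i then z else y j) =
  lp_objective B y + ((B *m z) i ord0 - (B *m y i) i ord0).
Proof.
rewrite !lp_objectiveE (bigD1 i) //= [in RHS](bigD1 i) //= eqxx.
rewrite (eq_bigr (fun j => (B *m y j) j ord0)) => [|j /negPf -> //].
by rewrite !addrA; ring.
Qed.

(** From an optimal solution, a step along [x'] in the variable [x] and along
    [y'] in the [i]-th block alone is feasible and changes the objective by
    the [i]-th entry of [B *m y']. *)
Lemma lp_optimal_no_free_enlargement ybar :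
  lp_has_optimal_solution B F C ybar -> no_free_enlargement.
Proof.
move=> [x [y [[hy hbar] opt]]] x' y' Ax' ABx' i; rewrite [leLHS]mxE.
have shift z : plus_cone F C x z -> plus_cone F C (x + x') z.
  move=> /hAB hz; apply/hAB => r; have := hz r; have := Ax' r.
  by rewrite mulmxDr !addcE mxE; lra.
have feas : lp_feasible F C ybar (x + x')
    (fun j => if j == i then y i + y' else y j).
  split=> [j|]; last exact: shift.
  case: eqP => [_|_]; last exact: shift.
  apply/hAB => r; have /hAB/(_ r) := hy i; have := ABx' r.
  by rewrite !mulmxDr !addcE mxE; lra.
by have := opt _ _ feas; rewrite objective_update mulmxDr addcE; lra.
Qed.

(** If the value at [x'] strictly contains the value at the optimal [x], it has
    a point [z] violating some inequality [i] that [y i] satisfies; replacing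
    [y i] by [z] improves the objective. This is why the program carries one
    block per inequality. *)
Lemma lp_optimal_maximal ybar : lp_has_optimal_solution B F C ybar ->
  exists2 x, maximal_value (plus_cone F C) x & plus_cone F C x ybar.
Proof.
move=> [x [y [[hy hbar] opt]]]; exists x => // -[x' [sub nsub]].
apply: nsub => z hz; apply/hAB; move=> i; rewrite leNgt; apply/negP => lt.
have feas : lp_feasible F C ybar x' (fun j => if j == i then z else y j).
  by split=> [j|]; [case: eqP => // _|]; exact: sub.
have /hAB/(_ i) := hy i; have := opt _ _ feas.
by move: lt; rewrite objective_update !addcE; lra.
Qed.

(** A direction [x'] with [A *m x' >= 0] can only enlarge values, so by
    maximality the value is the same along the whole ray from [x]; then the
    points [y0 + t y'] all lie in the value at [x]. *)
Lemma maximal_no_free_enlargement x :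
  plus_cone F C x !=set0 -> maximal_value (plus_cone F C) x ->
  no_free_enlargement.
Proof.
move=> [y0 hy0] xmax x' y' Ax' ABx'.
have grow t z : 0 <= t -> plus_cone F C x z -> plus_cone F C (x + t *: x') z.
  move=> t0 /hAB hz; apply/hAB => r; have := hz r; have := Ax' r.
  by rewrite mulmxDr -scalemxAr !addcE !scalcE mxE; nra.
have const t : 0 <= t -> plus_cone F C (x + t *: x') `<=` plus_cone F C x.
  move=> t0; apply: contrapT => nsub; apply: xmax; exists (x + t *: x').
  by split=> // z; exact: grow.
move=> i; rewrite [leLHS]mxE -oppr_le0.
apply: (@le0_of_ray _ _ ((A *m x + B *m y0) i ord0 - b i ord0)) => t t0.
have /(const _ t0)/hAB/(_ i) : plus_cone F C (x + t *: x') (y0 + t *: y').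
  apply/hAB => r; have /hAB/(_ r) := hy0; have := ABx' r.
  by rewrite !mulmxDr -!scalemxAr !addcE !scalcE ?mxE; nra.
by rewrite !mulmxDr -!scalemxAr !addcE !scalcE ?mxE; lra.
Qed.

End ParametricLP.

(** * The recession mapping *)

Section RecessionMap.
Context {R : realType} {n q : nat}.
Implicit Types (F : 'cV[R]_n -> set 'cV[R]_q) (C : set 'cV[R]_q).

Lemma recession_mapP F x y : recession_map F x y <->
  forall x0 y0 t, F x0 y0 -> 0 <= t -> F (x0 + t *: x) (y0 + t *: y).
Proof.
split=> [h x0 y0 t Fxy t0|h z t Fz t0].
  have := h (col_mx x0 y0) t; rewrite /graph /= scale_col_mx add_col_mx.
  by rewrite !col_mxKu !col_mxKd; apply.
by rewrite /graph /= !linearD !linearZ /= col_mxKu col_mxKd; exact: h.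
Qed.

Lemma plus_cone_sub F C : C 0 -> forall x, F x `<=` plus_cone F C x.
Proof. by move=> C0 x y Fxy; exists y => //; exists 0 => //; rewrite addr0. Qed.

Lemma upper_imageP F C y :
  upper_image F C y <-> exists x, plus_cone F C x y.
Proof.
split=> [[c Cc [z [x _ Fxz] <-]]|[x [z Fxz [c Cc <-]]]].
  by exists x, z => //; exists c => //; rewrite addrC.
by exists c => //; exists z; [exists x|rewrite addrC].
Qed.

Lemma dom_plus_cone F C x y : plus_cone F C x y -> dom F x.
Proof. by move=> [z Fxz _]; exists z. Qed.

Lemma recession_map_plus_coneE m (A : 'M[R]_(m, n)) (B : 'M[R]_(m, q))
    (b : 'cV[R]_m) F C :
  (forall x y, plus_cone F C x y <-> vec_le b (A *m x + B *m y)) ->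
  (exists x y, plus_cone F C x y) ->
  forall x y, recession_map (plus_cone F C) x y <->
    vec_le 0 (A *m x + B *m y).
Proof.
move=> hAB [x0 [y0 hxy]] x y; rewrite -mul_row_col.
rewrite -(@recession_cone_polyhedron _ _ _ (row_mx A B) b (col_mx x0 y0));
  last by rewrite mul_row_col; exact/hAB.
have -> // : [set z | vec_le b (row_mx A B *m z)] = graph (plus_cone F C).
apply/seteqP; split=> z; rewrite -[z]vsubmxK /graph /= mul_row_col.
  by move=> /hAB; rewrite col_mxKu col_mxKd.
by rewrite col_mxKu col_mxKd => /hAB.
Qed.

(** The graph of F_C is the image of {(x, y, c) | y - c in F x, c in C} under
    the projection forgetting c, and recession directions lift along
    projections of polyhedra. *)
Lemma plus_cone_recession_map F C :
  polyhedral_convex_map F -> polyhedral_convex_cone C -> feasible F ->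
  forall x y, plus_cone (recession_map F) C x y <->
    recession_map (plus_cone F C) x y.
Proof.
move=> [l [M [d gF]]] [[k [N [e CE]]] Ccone] [x0 [y0 Fxy0]] x y.
have FP u v : F u v <-> vec_le d (M *m col_mx u v).
  have -> : F u v = graph F (col_mx u v) by rewrite /graph /= col_mxKu col_mxKd.
  by rewrite gF.
split=> [[r /recession_mapP rF [c Cc <-]]|/recession_mapP rFC].
  apply/recession_mapP => u _ t [v Fuv [w Cw <-]] t0.
  rewrite scalerDr addrACA; exists (v + t *: r); first exact: rF.
  by exists (w + t *: c) => //; exact: (convex_cone_recession Ccone).
have C0 : C 0 by have [_ []] := Ccone.
pose f (o : 'I_l + 'I_k) (c : 'cV[R]_q) : R := match o with
  | inl i => - (M *m col_mx 0 c) i ord0 | inr i => (N *m c) i ord0 end.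
pose v (o : 'I_l + 'I_k) : R := match o with
  | inl i => d i ord0 - (M *m col_mx x0 y0) i ord0 | inr i => e i ord0 end.
pose u (o : 'I_l + 'I_k) : R := match o with
  | inl i => - (M *m col_mx x y) i ord0 | inr i => 0 end.
have f_lin o : scalar (f o).
  case: o => i a c1 c2 /=; last by rewrite linearP !mxE.
  have -> : col_mx 0 (a *: c1 + c2) =
      a *: col_mx 0 c1 + col_mx 0 c2 :> 'cV[R]_(n + q).
    by rewrite scale_col_mx add_col_mx scaler0 addr0.
  by rewrite linearP addcE scalcE; ring.
(* The system in c says that (x0, y0) + t (x, y) - (0, c) is in the graph of F
   and that c is in C. *)
have [|c hc] := @recession_of_solvability _ _ _ _ f_lin v u.
  move=> t t0; have [z Fz [c Cc zE]] := rFC _ _ t (plus_cone_sub C0 Fxy0) t0.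
  exists c => -[i|i] /=; last by move: Cc; rewrite CE mulr0 add0r; apply.
  have /FP/(_ i) := Fz.
  have -> : col_mx (x0 + t *: x) z =
      col_mx x0 y0 + t *: col_mx x y - col_mx 0 c :> 'cV[R]_(n + q).
    rewrite scale_col_mx add_col_mx opp_col_mx add_col_mx subr0 -zE.
    by rewrite addrK.
  by rewrite mulmxBr mulmxDr -scalemxAr !addcE scalcE oppcE; lra.
exists (y - c).
  rewrite /recession_map /= gF recession_cone_polyhedron; last exact/FP/Fxy0.
  move=> i; have := hc (inl i); rewrite /=.
  have -> : col_mx x (y - c) = col_mx x y - col_mx 0 c :> 'cV[R]_(n + q).
    by rewrite opp_col_mx add_col_mx subr0.
  by rewrite mulmxBr addcE !oppcE [(0 : 'cV_l) _ _]mxE; lra.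
exists c; last by rewrite subrK.
have : recession_cone C c.
  rewrite CE recession_cone_polyhedron; last by move: C0; rewrite CE; apply.
  by move=> i; rewrite mxE; exact: hc (inr i).
by move=> /(_ 0 1 C0 ler01); rewrite add0r scale1r.
Qed.

End RecessionMap.

(** * Existence of solutions *)

Section Solutions.
Context {R : realType} {n q m : nat}.
Variables (A : 'M[R]_(m, n)) (B : 'M[R]_(m, q)) (b : 'cV[R]_m).
Variables (F : 'cV[R]_n -> set 'cV[R]_q) (C : set 'cV[R]_q).
Hypothesis hF : polyhedral_convex_map F.
Hypothesis hC : polyhedral_convex_cone C.
Hypothesis hAB : forall x y, plus_cone F C x y <-> vec_le b (A *m x + B *m y).
Hypothesis Ffeas : feasible F.
Local Notation convex K := (convex_set (K : set (convex_lmodType _))).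

Let C0 : C 0. Proof. by case: hC => _ [_ []]. Qed.

Lemma recession_map_FC x y :
  recession_map (plus_cone F C) x y <-> vec_le 0 (A *m x + B *m y).
Proof.
apply: (recession_map_plus_coneE hAB).
by have [x0 [y0 hxy]] := Ffeas; exists x0, y0; exact: plus_cone_sub.
Qed.

Lemma plus_cone_hom x y :
  plus_cone (recession_map F) C x y <-> vec_le 0 (A *m x + B *m y).
Proof. by rewrite plus_cone_recession_map // recession_map_FC. Qed.

Lemma upper_image_sub x : F x `<=` upper_image F C.
Proof. by move=> y Fxy; apply/upper_imageP; exists x; exact: plus_cone_sub. Qed.

Lemma minimizer_above y : no_free_enlargement A B -> upper_image F C y ->
  exists2 x, minimizer F C x & plus_cone F C x y.
Proof.
move=> gain /upper_imageP hy.
have [x xmax xy] := lp_optimal_maximal hAB (lp_attained hAB gain hy).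
by exists x => //; split=> //; exact: dom_plus_cone xy.
Qed.

(** A minimizer of the homogeneous problem whose value contains [y] cannot be 0
    when [y] is not in the value at 0. *)
Lemma minimizing_direction_above y : no_free_enlargement A B ->
  upper_image (recession_map F) C y -> ~ vec_le 0 (B *m y) ->
  exists2 x, minimizing_direction F C x & plus_cone (recession_map F) C x y.
Proof.
move=> gain /upper_imageP hy By.
have [x xmax xy] := lp_optimal_maximal plus_cone_hom
  (lp_attained plus_cone_hom gain hy).
exists x => //; split; last 2 first.
- exact: dom_plus_cone xy.
- have <- // : plus_cone (recession_map F) C = recession_map (plus_cone F C).
  apply/funext => u; apply/seteqP.
  by split=> v; rewrite plus_cone_recession_map.
by apply/eqP => x0; apply: By; move: xy; rewrite x0 plus_cone_hom mulmx0 add0r.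
Qed.

Lemma zero_minimizes_homP :
  zero_minimizes_hom F C <-> no_free_enlargement A B.
Proof.
have E x y := recession_map_FC x y.
split=> [h x y Ax ABxy|gain [x [sub nsub]]]; last first.
  apply: nsub => y /E ABxy; apply/E; rewrite mulmx0 add0r.
  have /sub/E : recession_map (plus_cone F C) 0 0.
    by apply/E; rewrite !mulmx0 addr0.
  by rewrite mulmx0 addr0 => Ax; exact: gain ABxy.
apply: contrapT => By; apply: h; exists x; split=> [z /E|].
  rewrite mulmx0 add0r => Bz; apply/E => i.
  by have := Ax i; have := Bz i; rewrite addcE mxE; lra.
by move=> /(_ y); rewrite !E mulmx0 add0r => /(_ ABxy).
Qed.

Lemma convex_upper_image : convex (upper_image F C).
Proof.
apply/convex_setP => t y1 y2 t0 t1 /upper_imageP[x1 /hAB h1].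
move=> /upper_imageP[x2 /hAB h2]; apply/upper_imageP.
exists (t *: x1 + (1 - t) *: x2); apply/hAB => i.
have := h1 i; have := h2 i.
by rewrite !mulmxDr -!scalemxAr !addcE !scalcE; nra.
Qed.

Lemma recession_upper_image x : recession_map F x `<=`
  recession_cone (upper_image F C).
Proof.
move=> y /recession_mapP ry z t /upper_imageP[u [v Fuv [c Cc <-]]] t0.
apply/upper_imageP; exists (u + t *: x); rewrite addrAC.
by exists (v + t *: y); [exact: ry|exists c].
Qed.

Lemma recession_upper_image_cone : C `<=` recession_cone (upper_image F C).
Proof.
move=> c Cc; apply: recession_setaddl.
by have [_ Ccone] := hC; exact: convex_cone_recession.
Qed.

Lemma recession_value c x : recession_map F 0 c -> recession_cone (F x) c.
Proof.
move=> /recession_mapP rc y t Fxy t0.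
by have := rc _ _ t Fxy t0; rewrite scaler0 addr0.
Qed.

Lemma generated_sub_upper_image (Sbar Shat : set 'cV[R]_n) :
  setadd (setadd C (conv_hull (\bigcup_(x in Sbar) F x)))
         (cone_hull (\bigcup_(x in Shat) recession_map F x))
  `<=` upper_image F C.
Proof.
move=> _ [_ [c Cc [v hv <-]] [w hw <-]].
have Pv : upper_image F C v.
  apply: hv; split; first exact: convex_upper_image.
  by move=> y [x _]; exact: upper_image_sub.
have rw : recession_cone (upper_image F C) w.
  apply: hw; split; first exact/recession_cone_convex_cone/convex_upper_image.
  by move=> y [x _]; exact: recession_upper_image.
have := recession_coneD (recession_upper_image_cone Cc) rw.
by move=> /(_ _ 1 Pv ler01); rewrite scale1r addrA [v + c]addrC.
Qed.

(** Take minimizers above the generating points of the graph of F and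
    minimizing directions above its generating rays. Rays (x, y) with
    [B *m y >= 0] may admit only the direction 0, which a solution excludes;
    but then [y] is in (0^+F)(0) + C, so it is already a recession direction
    of C plus the hull of the values. *)
Lemma solution_exists : no_free_enlargement A B ->
  exists Sbar Shat, solution F C Sbar Shat.
Proof.
move=> gain.
have [V [W [Vfin Wfin VF WF gen]]] := polyhedron_finitely_generated hF.
have Vmin z : exists x, V z -> minimizer F C x /\ plus_cone F C x (dsubmx z).
  have [Vz|nVz] := pselect (V z); last by exists 0.
  have [x] := minimizer_above gain (upper_image_sub (VF _ Vz)).
  by exists x.
have [xbar xbarP] := choice Vmin.
pose W' := [set z | W z /\ ~ vec_le 0 (B *m dsubmx z)].
have rWF z : W z -> recession_map F (usubmx z) (dsubmx z).
  by move=> Wz; rewrite /recession_map /= vsubmxK; exact: WF.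
have Wmin z : exists x, W' z -> minimizing_direction F C x /\
    plus_cone (recession_map F) C x (dsubmx z).
  have [W'z|nWz] := pselect (W' z); last by exists 0.
  have [Wz Bz] := W'z.
  have Pz : upper_image (recession_map F) C (dsubmx z).
    apply/upper_imageP; exists (usubmx z).
    by apply: plus_cone_sub => //; exact: rWF.
  have [x] := minimizing_direction_above gain Pz Bz.
  by exists x.
have [xhat xhatP] := choice Wmin.
have Ccone : convex_cone C by case: hC.
set Sbar := xbar @` V; set Shat := xhat @` W'; exists Sbar, Shat.
have Smin : Sbar `<=` minimizer F C by move=> _ [z /xbarP[h _] <-].
have Sdir : Shat `<=` minimizing_direction F C by move=> _ [z /xhatP[h _] <-].
split=> //; split.
- split; first exact: finite_image.
  by apply: finite_image; apply: sub_finite_set Wfin => z [].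
- (* Without generating points the empty set would contain the graph. *)
  apply/set0P/eqP => S0; have [x [y Fxy]] := Ffeas.
  have V0 : V `<=` set0.
    by move=> z Vz; have : Sbar (xbar z) by [exists z]; rewrite S0.
  have /(_ (col_mx x y)) : graph F `<=` set0.
    by apply: gen => [x1 x2 s /set_mem [] || w _ z t []].
  by rewrite /graph /= col_mxKu col_mxKd => /(_ Fxy).
- by move=> x /Smin[].
- by move=> x /Sdir[x0 xdom _]; split=> // /eqP; rewrite (negPf x0).
apply/seteqP; split; last exact: generated_sub_upper_image.
set H := conv_hull _; set K := cone_hull _; set Q := setadd _ K.
have Kcone : convex_cone K by exact: convex_cone_hull.
have Qconv : convex Q.
  apply: convex_setadd; last by case: Kcone.
  by apply: convex_setadd; [case: Ccone|exact: convex_conv_hull].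
have QC c : C c -> recession_cone Q c.
  move=> Cc; do 2!apply: recession_setaddl.
  exact: convex_cone_recession Ccone _ Cc.
have QW z : W z -> recession_cone Q (dsubmx z).
  move=> Wz; have [Bz|Bz] := pselect (vec_le 0 (B *m dsubmx z)).
    have /plus_cone_hom[r r0 [c Cc <-]] : vec_le 0 (A *m 0 + B *m dsubmx z).
      by rewrite mulmx0 add0r.
    apply: recession_coneD; last exact: QC.
    apply: recession_setaddl; apply: recession_setaddr.
    by apply: recession_conv_hull => x _; exact: recession_value.
  have W'z : W' z by [].
  have [_ [r rx [c Cc <-]]] := xhatP _ W'z.
  apply: recession_coneD; last exact: QC.
  apply: recession_setaddr; apply: convex_cone_recession => //.
  by apply: sub_gen_smallest; exists (xhat z) => //; exists z.
have VQ z : V z -> Q (dsubmx z).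
  move=> Vz; have [_ [y Fy [c Cc <-]]] := xbarP _ Vz.
  exists (c + y); last by exists 0; [case: Kcone => _ []|rewrite addr0 addrC].
  exists c => //; exists y => //.
  by apply: sub_gen_smallest; exists (xbar z) => //; exists z.
have FQ x y : F x y -> Q y.
  move=> Fxy; have := gen (dsubmx @^-1` Q) _ VQ _ (col_mx x y).
  rewrite /graph /= col_mxKu col_mxKd; apply=> //.
    apply/convex_setP => t u v t0 t1 /= Qu Qv.
    by rewrite linearD !linearZ /=; move/convex_setP: Qconv; apply.
  by move=> w Ww u t /= Qu t0; rewrite linearD linearZ /=; exact: QW.
move=> _ [c Cc [y [x _ Fxy] <-]].
by have := QC _ Cc _ 1 (FQ _ _ Fxy) ler01; rewrite scale1r addrC.
Qed.

End Solutions.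

Theorem theorem3p3 (R : realType) (n q m : nat)
    (F : 'cV[R]_n -> set 'cV[R]_q) (C : set 'cV[R]_q)
    (A : 'M[R]_(m, n)) (B : 'M[R]_(m, q)) (b : 'cV[R]_m)
    (hF : polyhedral_convex_map F) (hC : polyhedral_convex_cone C)
    (hAB : forall x y, plus_cone F C x y <-> vec_le b (A *m x + B *m y)) :
  let c1 := exists2 ybar, upper_image F C ybar &
              exists2 xbar, minimizer F C xbar & plus_cone F C xbar ybar in
  let c2 := forall ybar, upper_image F C ybar ->
              exists2 xbar, minimizer F C xbar & plus_cone F C xbar ybar in
  let c3 := exists2 ybar, upper_image F C ybar &
              lp_has_optimal_solution B F C ybar in
  let c4 := forall ybar, upper_image F C ybar ->
              lp_has_optimal_solution B F C ybar in
  let c5 := lp_hom_has_optimal_solution B F C in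
  let c6 := zero_minimizes_hom F C in
  ((exists Sbar Shat, solution F C Sbar Shat) <->
     feasible F /\ (c1 \/ c2 \/ c3 \/ c4 \/ c5 \/ c6)) /\
  (feasible F -> [<-> c1; c2; c3; c4; c5; c6]).
Proof.
move=> c1 c2 c3 c4 c5 c6.
have C0 : C 0 by case: hC => _ [_ []].
pose gain := no_free_enlargement A B.
have c1_gain : c1 -> gain.
  move=> [y _ [x [_ xmax] xy]].
  by apply: (maximal_no_free_enlargement hAB _ xmax); exists y.
have gain_c2 : gain -> c2.
  by move=> g y hy; exact: (minimizer_above hAB).
have gain_c4 : gain -> c4.
  by move=> g y /upper_imageP; exact: (lp_attained hAB).
have c3_gain : c3 -> gain.
  by move=> [y _]; exact: (lp_optimal_no_free_enlargement hAB).
have exP : feasible F -> exists y, upper_image F C y.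
  move=> [x [y /(plus_cone_sub C0) xy]].
  by exists y; apply/upper_imageP; exists x.
have c2_c1 : feasible F -> c2 -> c1.
  by move=> /exP[y hy] h2; exists y => //; exact: h2.
have c4_c3 : feasible F -> c4 -> c3.
  by move=> /exP[y hy] h4; exists y => //; exact: h4.
have c5P : feasible F -> c5 <-> gain.
  move=> Ffeas; have hom := plus_cone_hom hF hC hAB Ffeas.
  split=> [|g]; first exact: (lp_optimal_no_free_enlargement hom).
  apply: (lp_attained hom) => //; exists 0; apply/hom => i.
  by rewrite !mulmx0 addr0.
have c6P : feasible F -> c6 <-> gain.
  by move=> Ffeas; exact: (zero_minimizes_homP hC hAB).
have equiv : feasible F -> [<-> c1; c2; c3; c4; c5; c6].
  move=> Ff; tfae.
  - by move=> /c1_gain.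
  - by move=> /(c2_c1 Ff)/c1_gain/gain_c4/(c4_c3 Ff).
  - by move=> /c3_gain.
  - by move=> /(c4_c3 Ff)/c3_gain/(c5P Ff).
  - by move=> /(c5P Ff)/(c6P Ff).
  - by move=> /(c6P Ff)/gain_c2/(c2_c1 Ff).
split=> //; split=> [[Sbar [Shat [[_ [x Sx] domS _ _] Smin _]]]|[Ff hc]].
  have Ff : feasible F by exists x; exact: domS.
  split=> //; left; have [y Fxy] := domS _ Sx.
  have xy : plus_cone F C x y by exact: plus_cone_sub.
  exists y; first by apply/upper_imageP; exists x.
  by exists x => //; exact: Smin.
apply: (solution_exists hF hC hAB Ff).
case: hc => [/c1_gain //|[/(c2_c1 Ff)/c1_gain //|[/c3_gain //|]]].
by case=> [/(c4_c3 Ff)/c3_gain //|[/(c5P Ff) //|/(c6P Ff)]].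
Qed.
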